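(* Let $p\in[1,\infty)$ and $\lambda\in[-n/p,1]$. Then the family $\{\mathcal L_{p,\lambda}(Q_r)\}_{0<r<\infty}$ has the decomposition property. More precisely, for any $f\in(\mathcal L_{p,\lambda})_Q(\mathbb R^n)$ and any $r>0$, let $$f_0^r=(f-f_{Q_{2r}})h_r,\qquad f_1^r=f-(f-f_{Q_{2r}})h_r.$$ Then $f=f_0^r+f_1^r$, $$\|f_0^r\|_{\mathcal L_{p,\lambda}(Q_t)}\le\begin{cases}C\|f\|_{\mathcal L_{p,\lambda}(Q_t)}&(0<t<r),\\ C\|f\|_{\mathcal L_{p,\lambda}(Q_{3r})}&(r\le t<\infty),\end{cases}$$ and $$\|f_1^r\|_{\mathcal L_{p,\lambda}(Q_t)}\le\begin{cases}0&(0<t<r),\\ C\|f\|_{\mathcal L_{p,\lambda}(Q_{3t})}&(r\le t<\infty),\end{cases}$$ where $C$ is a positive constant independent of $r$, $t$ and $f$.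
   Context: For $r>0$, $Q_r\subset\mathbb R^n$ is the open cube $\{y:\max_i|y_i|<r\}$ (for all $r$), or the open ball $\{y:|y|<r\}$ (for all $r$); $Q(x,s)=x+Q_s$; $f_G=\frac1{|G|}\int_G f$. For $U=\mathbb R^n$ or $U=Q_r$, the Campanato space $\mathcal L_{p,\lambda}(U)$ consists of all $f$ with $$\|f\|_{\mathcal L_{p,\lambda}(U)}=\sup_{Q(x,s)\subset U}\frac1{s^\lambda}\left(\frac1{|Q(x,s)|}\int_{Q(x,s)}|f(y)-f_{Q(x,s)}|^p\,dy\right)^{1/p}<\infty ,$$ regarded as a space of functions modulo constants. $(\mathcal L_{p,\lambda})_Q(\mathbb R^n)$ is the set of measurable $f$ on $\mathbb R^n$ with $f|_{Q_r}\in\mathcal L_{p,\lambda}(Q_r)$ for all $r>0$. The function $h:\mathbb R^n\to\mathbb R$ satisfies $h(x)=1$ for $|x|\le1$, $h(x)=0$ for $|x|\ge2$, and $\|h\|_{\mathrm{Lip}_1(\mathbb R^n)}=\sup_{x\ne y}|h(x)-h(y)|/|x-y|\le1$; here $|x|$ in the first two conditions is the norm whose open unit ball is $Q_1$. Set $h_r(x)=h(x/r)$. Decomposition property of a family $\{E(Q_r)\}$: there are positive constants $C_E,a,b,c$ such that for every $f\in E_Q(\mathbb R^n)$ (i.e. $f|_{Q_r}\in E(Q_r)$ for all $r>0$) and every $r>0$ there is a decomposition $f=f_0^r+f_1^r$ with $\|f_0^r\|_{E(Q_t)}\le C_E\|f\|_{E(Q_t)}$ for $0<t<r$, $\|f_0^r\|_{E(Q_t)}\le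 C_E\|f\|_{E(Q_{ar})}$ for $r\le t<\infty$, $\|f_1^r\|_{E(Q_t)}=0$ for $0<t<cr$, and $\|f_1^r\|_{E(Q_t)}\le C_E\|f\|_{E(Q_{bt})}$ for $cr\le t<\infty$. *)

(* Defs.v *)
From HB Require Import structures.
From mathcomp Require Import all_boot all_order all_algebra.
From mathcomp Require Import all_classical all_reals all_analysis.

Set Implicit Arguments.
Unset Strict Implicit.
Unset Printing Implicit Defensive.
Import Order.TTheory GRing.Theory Num.Theory.
Import numFieldNormedType.Exports.
Local Open Scope classical_set_scope.
Local Open Scope ring_scope.

(* Row vectors carry the sigma-algebra generated by the coordinate maps, that
   is, the Borel sigma-algebra of R^n. *)
Definition rV_display : measure_display.
Proof. exact: default_measure_display. Qed.

Section measurable_rV.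
Variables (R : realType) (n : nat).

Let coor (i : 'I_n) (v : 'rV[R]_n) : measurableTypeR R := v 0 i.

Let rV_set0 : g_sigma_preimage coor set0.
Proof. exact: sigma_algebra0. Qed.

Let rV_setC A : g_sigma_preimage coor A -> g_sigma_preimage coor (~` A).
Proof. exact: sigma_algebraC. Qed.

Let rV_bigcup (F : _^nat) : (forall i, g_sigma_preimage coor (F i)) ->
  g_sigma_preimage coor (\bigcup_i (F i)).
Proof. exact: sigma_algebra_bigcup. Qed.

HB.instance Definition _ := @isMeasurable.Build rV_display
  'rV[R]_n (g_sigma_preimage coor) rV_set0 rV_setC rV_bigcup.

Lemma measurable_coor (i : 'I_n) :
  measurable_fun [set: 'rV[R]_n] (fun v => v 0 i : measurableTypeR R).
Proof.
move=> _ Y mY; rewrite setTI; apply: sub_sigma_algebra => /=.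
rewrite -bigcup_seq/=; exists i => /=; first by rewrite mem_index_enum.
by exists Y => //; rewrite setTI.
Qed.

Lemma measurable_fun_rVP d (T : measurableType d) (f : T -> 'rV[R]_n) :
  measurable_fun [set: T] f <->
  forall i, measurable_fun [set: T] (fun x => f x 0 i : measurableTypeR R).
Proof.
split=> [mf i|mf].
  exact: (measurableT_comp (measurable_coor i) mf).
apply: (@measurability _ _ _ _ setT f
  (\big[setU/set0]_(i < n) preimage_set_system setT (coor i) measurable)).
  by [].
move=> _ [A + <-]; rewrite setTI.
rewrite -bigcup_seq => -[i _ [B mB <-]].
by rewrite setTI -[X in measurable X]setTI; exact: mf.
Qed.

End measurable_rV.

Definition cons_rV (R : realType) (n : nat) (z : measurableTypeR R * 'rV[R]_n) :
  'rV[R]_n.+1 := row_mx (const_mx z.1 : 'rV[R]_1) z.2.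

Definition uncons_rV (R : realType) (n : nat) (v : 'rV[R]_n.+1) :
  measurableTypeR R * 'rV[R]_n := (v 0 ord0, rsubmx (v : 'rV[R]_(1 + n))).

Lemma cons_rVK (R : realType) n : cancel (@cons_rV R n) (@uncons_rV R n).
Proof.
move=> [x y]; rewrite /uncons_rV /cons_rV/= row_mxKr; congr pair.
rewrite (_ : ord0 = lshift n (ord0 : 'I_1)); last exact: val_inj.
exact: etrans (row_mxEl _ _ _ _) (mxE _ _ _ _).
Qed.

Lemma measurable_cons_rV (R : realType) n :
  measurable_fun [set: measurableTypeR R * 'rV[R]_n] (@cons_rV R n).
Proof.
apply/measurable_fun_rVP => i; rewrite /cons_rV.
case: (@split_ordP 1 n i) => j ->.
- apply: (eq_measurable_fun fst) => [z _|]; last exact: measurable_fst.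
  exact: esym (etrans (row_mxEl _ _ _ _) (mxE _ _ _ _)).
- apply: (eq_measurable_fun
    (fun z : _ * 'rV[R]_n => z.2 0 j : measurableTypeR R)) => [z _|].
    exact: esym (row_mxEr _ _ _ _).
  exact: (measurableT_comp (measurable_coor j) measurable_snd).
Qed.

Lemma measurable_uncons_rV (R : realType) n :
  measurable_fun [set: 'rV[R]_n.+1] (@uncons_rV R n).
Proof.
apply/measurable_fun_pairP; split; first exact: measurable_coor.
apply/measurable_fun_rVP => j.
apply: (eq_measurable_fun
  (fun v : 'rV[R]_n.+1 => v 0 (rshift 1 j) : measurableTypeR R)) => [v _|].
  by rewrite /= mxE.
exact: measurable_coor.
Qed.

Section cons_measure.
Local Open Scope ereal_scope.
Variables (R : realType) (n : nat).
Variable m : {sigma_finite_measure set 'rV[R]_n -> \bar R}.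

Definition cons_measure : set 'rV[R]_n.+1 -> \bar R :=
  pushforward (@lebesgue_measure R \x m) (@cons_rV R n).

Let mpre A : measurable A -> measurable (@cons_rV R n @^-1` A).
Proof.
by move=> mA; rewrite -[X in measurable X]setTI; exact: measurable_cons_rV.
Qed.

Let cons_measure0 : cons_measure set0 = 0.
Proof. by rewrite /cons_measure /pushforward preimage_set0 measure0. Qed.

Let cons_measure_ge0 A : 0 <= cons_measure A.
Proof. by rewrite /cons_measure /pushforward measure_ge0. Qed.

Let cons_measure_semi_sigma_additive : semi_sigma_additive cons_measure.
Proof.
move=> F mF tF mUF; rewrite /cons_measure /pushforward preimage_bigcup.
apply: measure_semi_sigma_additive.
- by move=> k; exact: mpre.
- apply/trivIsetP => /= i j _ _ ij; rewrite -preimage_setI.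
  by move/trivIsetP : tF => /(_ _ _ _ _ ij) ->//; rewrite preimage_set0.
- by rewrite -preimage_bigcup; exact: mpre.
Qed.

HB.instance Definition _ := isMeasure.Build _ _ _ cons_measure
  cons_measure0 cons_measure_ge0 cons_measure_semi_sigma_additive.

Let cons_measure_sigma_finite : sigma_finite setT cons_measure.
Proof.
have /sigma_finiteP[F [TF ndF Foo]] := sigma_finiteT (@lebesgue_measure R).
have /sigma_finiteP[G [TG ndG Goo]] := sigma_finiteT m.
exists (fun k => @uncons_rV R n @^-1` (F k `*` G k)).
  rewrite -preimage_bigcup (_ : \bigcup_k _ = setT) ?preimage_setT//.
  rewrite -setXTT TF TG predeqE => -[x y]; split.
    by move=> [k _ []]; split; exists k.
  move=> [/= [i _ Fix] [k _ Gky]]; exists (maxn i k) => //; split.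
  - by move: x Fix; exact/subsetPset/ndF/leq_maxl.
  - by move: y Gky; exact/subsetPset/ndG/leq_maxr.
move=> k; have [mF Fk] := Foo k; have [mG Gk] := Goo k.
have mFG : measurable (F k `*` G k) by exact: measurableX.
split.
  by rewrite -[X in measurable X]setTI; exact: measurable_uncons_rV.
rewrite /cons_measure /pushforward -comp_preimage.
rewrite (_ : _ \o _ = id); last by apply/funext => z; exact: cons_rVK.
by rewrite preimage_id product_measure1E// lte_mul_pinfty// ge0_fin_numE.
Qed.

HB.instance Definition _ :=
  Measure_isSigmaFinite.Build _ _ _ cons_measure cons_measure_sigma_finite.

End cons_measure.

Fixpoint borel_lebesgue_rV (R : realType) (n : nat) :
    {sigma_finite_measure set 'rV[R]_n -> \bar R} :=
  match n with
  | 0%N => [the {sigma_finite_measure set 'rV[R]_0 -> \bar R} of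
            \d_ (0 : 'rV[R]_0)]
  | m.+1 => [the {sigma_finite_measure set 'rV[R]_m.+1 -> \bar R} of
             cons_measure (borel_lebesgue_rV R m)]
  end.

(* R^n with the sigma-algebra of Lebesgue measurable sets, and the Lebesgue
   measure on it: the completion of the n-fold Borel product measure. *)
Definition lebesgue_space (R : realType) (n : nat) : measurableType _ :=
  caratheodory_type ((borel_lebesgue_rV R n)^*)%mu.

Definition lebesgue_rV (R : realType) (n : nat) :
    {measure set (lebesgue_space R n) -> \bar R} :=
  @completed_measure_extension _ _ _ (borel_lebesgue_rV R n).

Variant cell_shape := Cube | Ball.

Section campanato.
Variables (R : realType) (n : nat) (sh : cell_shape).
Implicit Types (f h : 'rV[R]_n -> R) (U : set 'rV[R]_n).

Definition enorm (x : 'rV[R]_n) : R := Num.sqrt (\sum_(i < n) x 0 i ^+ 2).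

(* the norm whose open unit ball is Q_1 *)
Definition gauge (x : 'rV[R]_n) : R :=
  match sh with
  | Cube => \big[Num.max/0]_(i < n) `|x 0 i|
  | Ball => enorm x
  end.

Definition Q (r : R) : set 'rV[R]_n := [set y | gauge y < r].

Definition Qat (x : 'rV[R]_n) (s : R) : set 'rV[R]_n := [set x + y | y in Q s].

Definition average f U : R :=
  (fine (lebesgue_rV R n U))^-1 * \int[lebesgue_rV R n]_(y in U) f y.

(* The integral is extended-real, so that an f for which the average over some
   Q(x,s) inside U is not defined (f not integrable there) has norm +oo,
   whatever real value [average] takes. *)
Definition mean_oscillation (p : R) f U : \bar R :=
  poweR (((fine (lebesgue_rV R n U))^-1)%:E *
         \int[lebesgue_rV R n]_(y in U) (`|f y - average f U| `^ p)%:E)%E p^-1.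

Definition campanato_norm (p lam : R) U f : \bar R :=
  ereal_sup [set e | exists (x : 'rV[R]_n) (s : R), [/\ 0 < s, Qat x s `<=` U &
    e = (((s `^ lam)^-1)%:E * mean_oscillation p f (Qat x s))%E]].

Definition campanato (p lam : R) U : set ('rV[R]_n -> R) :=
  [set f | measurable_fun (U : set (lebesgue_space R n)) f /\
           (campanato_norm p lam U f < +oo)%E].

End campanato.

(* A family {E(Q_r)} of (semi)normed function spaces. A function on Q_r is
   represented by any function on R^n that restricts to it. *)
Record function_spaces (R : realType) (n : nat) := FunctionSpaces {
  fs_mem : R -> set ('rV[R]_n -> R) ;
  fs_norm : R -> ('rV[R]_n -> R) -> \bar R }.

Definition campanato_spaces (R : realType) (n : nat) (sh : cell_shape) (p lam : R) :
    function_spaces R n :=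
  {| fs_mem r := campanato sh p lam (Q sh r) ;
     fs_norm r := campanato_norm sh p lam (Q sh r) |}.

(* the space written E_Q(R^n) *)
Definition global_space (R : realType) (n : nat) (E : function_spaces R n) :
    set ('rV[R]_n -> R) :=
  [set f | measurable_fun [set: lebesgue_space R n] f /\
           forall r, 0 < r -> fs_mem E r f].

Definition decomposition_property (R : realType) (n : nat)
    (E : function_spaces R n) : Prop :=
  exists CE a b c : R, [/\ 0 < CE, 0 < a, 0 < b, 0 < c &
    forall f, global_space E f -> forall r : R, 0 < r ->
    exists f0 f1 : 'rV[R]_n -> R,
      [/\ (forall x, f x = f0 x + f1 x),
          (forall t : R, 0 < t -> fs_mem E t f0 /\ fs_mem E t f1),
          (forall t : R, 0 < t < r ->
             (fs_norm E t f0 <= CE%:E * fs_norm E t f)%E) /\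
          (forall t : R, r <= t ->
             (fs_norm E t f0 <= CE%:E * fs_norm E (a * r) f)%E),
          (forall t : R, 0 < t < c * r -> fs_norm E t f1 = 0%E) &
          (forall t : R, c * r <= t ->
             (fs_norm E t f1 <= CE%:E * fs_norm E (b * t) f)%E)]].

(* The Lipschitz seminorm is taken with respect to the Euclidean norm, for
   cubes as well as for balls. *)
Definition lip1_norm (R : realType) (n : nat) (h : 'rV[R]_n -> R) : \bar R :=
  ereal_sup [set e | exists x y : 'rV[R]_n,
    x != y /\ e = (`|h x - h y| / enorm (x - y))%:E].

Definition cutoff (R : realType) (n : nat) (sh : cell_shape) (h : 'rV[R]_n -> R) : Prop :=
  [/\ (forall x, gauge sh x <= 1 -> h x = 1),
      (forall x, 2 <= gauge sh x -> h x = 0) &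
      (lip1_norm h <= 1)%E].

(* Main.v *)
Require Import Defs.
From mathcomp Require Import all_boot all_order all_algebra.
From mathcomp Require Import all_classical all_reals all_analysis.
From mathcomp Require Import measurable_realfun ring lra.
Set Implicit Arguments.
Unset Strict Implicit.
Unset Printing Implicit Defensive.
Import Order.TTheory GRing.Theory Num.Theory.
Import numFieldNormedType.Exports.
Local Open Scope classical_set_scope.
Local Open Scope ring_scope.

(** Since [h_r = 1] on [Q_r], on a cell inside [Q_r] the function [f_0] is [f]
    minus a constant and [f_1] is a constant; this settles [t < r].  All the
    other bounds follow from one estimate: on an arbitrary cell [Q(x,s)], of
    whatever size and position, [f_0] is within [C N s^lam] of some constant in
    [L^p] mean, where [N] is the norm of [f] on [Q_{3r}].  The bound on [f_1]
    is then obtained by subtraction, as [Q_t] and [Q_{3r}] both lie in [Q_{3t}].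

    Large cells, [r/2 <= s] ([truncation_far]).  The constant is [0].  The
    integral of [|f_0|^p] over [Q(x,s)] is at most a multiple of that of
    [|f - f_{Q_2r}|^p] over [Q_{2r}], that is, of [|Q_{2r}| (N (2r)^lam)^p].
    After division by [|Q(x,s)|] this leaves a factor [(2r/s)^(n/p + lam)],
    which is bounded precisely because [-n/p <= lam].

    Small cells, [s < r/2] ([truncation_near]).  Such a cell [Q] either misses
    [Q_{2r}], where [f_0] lives, or is contained in [Q_{3r}].  In the second
    case
      [f_0 - (f_Q - f_{Q_2r}) h_r(x)
         = (f - f_Q) h_r + (f_Q - f_{Q_2r}) (h_r - h_r(x))]
    where [h_r - h_r(x)] is of order [s/r] on [Q], so that it is enough to have
    [|f_Q - f_{Q_2r}| <= C N r s^(lam-1)].  This is [average_chain], proved by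
    doubling the radius repeatedly: up to a constant factor, the increments of
    the average are at most
      [N (2^k s)^lam <= N s^(lam-1) 2^k s]
    as [lam <= 1], and the right-hand sides sum up geometrically to a multiple
    of [N r s^(lam-1)].

    Since constant factors do not matter, the mean oscillation around the
    average may be replaced by the distance to an arbitrary constant
    ([Lp_close], [campanato_norm_le]), the inequalities of Jensen and Minkowski
    by elementary pointwise ones, and the exact measure of a cell by the
    measures of a box inside it and of a box around it. *)

(** * Closeness to a constant in L^p mean *)

Lemma powR_le2D (R : realType) (p a b : R) : 0 <= p -> 0 <= a -> 0 <= b ->
  (a + b) `^ p <= 2 `^ p * (a `^ p + b `^ p).
Proof.
move=> p0; wlog ab : a b / a <= b.
  move=> H a0 b0; have [/H|/ltW/H] := leP a b; first exact.
  by rewrite addrC [X in _ <= _ * X]addrC; exact.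
move=> a0 b0; apply: (@le_trans _ _ ((2 * b) `^ p)).
  by apply: ge0_ler_powR; rewrite ?nnegrE; lra.
by rewrite powRM// ler_pM2l ?powR_gt0// lerDr powR_ge0.
Qed.

Lemma powRD_le (R : realType) (p a b : R) : 1 <= p -> 0 <= a -> 0 <= b ->
  a `^ p + b `^ p <= (2 * (a + b)) `^ p.
Proof.
move=> p1 a0 b0; have p0 : 0 <= p by lra.
have ha : a `^ p <= (a + b) `^ p by apply: ge0_ler_powR; rewrite ?nnegrE; lra.
have hb : b `^ p <= (a + b) `^ p by apply: ge0_ler_powR; rewrite ?nnegrE; lra.
rewrite powRM//; last lra.
have h2 : (2 : R) <= 2 `^ p by rewrite -[leLHS]powRr1// ler_powR//; lra.
apply: (le_trans (lerD ha hb)).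
rewrite [leLHS](_ : _ = 2 * (a + b) `^ p); last by ring.
by rewrite ler_wpM2r ?powR_ge0.
Qed.

Section Lp_close.
Context d (T : measurableType d) (R : realType).
Variables (mu : {measure set T -> \bar R}) (p : R).
Hypothesis p1 : 1 <= p.
Implicit Types (U V W : set T) (f g k : T -> R) (a b c A B D K M : R).

(** The mean over [U] of [|g - c|^p] is at most [B^p].  Multiplying out by the
    measure of [U] keeps the integral alone on the left. *)
Definition Lp_close g U (c B : R) : Prop :=
  (\int[mu]_(y in U) (`|g y - c| `^ p)%:E <= (fine (mu U) * B `^ p)%:E)%E.

Let p0 : 0 <= p. Proof. exact: le_trans ler01 p1. Qed.

Lemma measurable_powR_dist g U c : measurable_fun U g ->
  measurable_fun U (fun y => (`|g y - c| `^ p)%:E).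
Proof.
move=> mg; apply/measurable_EFinP.
apply: (measurableT_comp (measurable_powR p)).
by apply: measurableT_comp => //; exact: measurable_funB.
Qed.

Lemma Lp_close_mono g U c B B' : 0 <= B -> B <= B' ->
  Lp_close g U c B -> Lp_close g U c B'.
Proof.
have hp := p1.
move=> B0 BB' /le_trans; apply; rewrite lee_fin ler_wpM2l ?fine_ge0//.
by apply: ge0_ler_powR; rewrite ?nnegrE; lra.
Qed.

Lemma Lp_close_cst U D : measurable U -> (mu U < +oo)%E -> 0 <= D ->
  Lp_close (cst D) U 0 D.
Proof.
move=> mU Uoo D0; rewrite /Lp_close/=.
under eq_integral do rewrite subr0 ger0_norm//.
by rewrite integral_cst// muleC EFinM fineK// ge0_fin_numE.
Qed.

(** Stands in for Minkowski's inequality.  The domination is pointwise so that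
    the same lemma covers sums, differences, changes of the constant and
    products with a cutoff. *)
Lemma Lp_close_leD {U g k f a b c A B} : measurable U ->
  measurable_fun U g -> measurable_fun U k -> measurable_fun U f ->
  0 <= A -> 0 <= B ->
  (forall y, U y -> `|f y - c| <= `|g y - a| + `|k y - b|) ->
  Lp_close g U a A -> Lp_close k U b B -> Lp_close f U c (4 * (A + B)).
Proof.
have hp := p1.
move=> mU mg mk mf A0 B0 fgk gA kB; rewrite /Lp_close.
apply: (@le_trans _ _ (\int[mu]_(y in U)
   ((2 `^ p)%:E * ((`|g y - a| `^ p)%:E + (`|k y - b| `^ p)%:E)))%E).
  apply: ge0_le_integral => //.
  - exact: measurable_powR_dist.
  - by apply: measurable_funeM; apply: emeasurable_funD;
      exact: measurable_powR_dist.
  - move=> y Uy; rewrite -EFinD -EFinM lee_fin.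
    apply: le_trans _ (powR_le2D p0 (normr_ge0 _) (normr_ge0 _)).
    by apply: ge0_ler_powR; rewrite ?nnegrE ?addr_ge0// fgk.
rewrite ge0_integralZl//; last 2 first.
- by apply: emeasurable_funD; exact: measurable_powR_dist.
- by move=> y _; rewrite adde_ge0// lee_fin powR_ge0.
rewrite ge0_integralD//; last 2 first.
- exact: measurable_powR_dist.
- exact: measurable_powR_dist.
apply: (@le_trans _ _ ((2 `^ p)%:E *
    ((fine (mu U) * A `^ p)%:E + (fine (mu U) * B `^ p)%:E))%E).
  by apply: lee_wpmul2l; rewrite ?lee_fin ?powR_ge0// leeD.
rewrite -EFinD -EFinM lee_fin -mulrDr mulrCA ler_wpM2l ?fine_ge0//.
rewrite (_ : 4 * (A + B) = 2 * (2 * (A + B))); last by ring.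
by rewrite [leRHS]powRM ?ler_pM2l ?powR_gt0 ?powRD_le//; lra.
Qed.

Lemma Lp_close_shift {U g c c' B D} : measurable U -> (mu U < +oo)%E ->
  measurable_fun U g -> 0 <= B -> `|c - c'| <= D ->
  Lp_close g U c B -> Lp_close g U c' (4 * (B + D)).
Proof.
move=> mU Uoo mg B0 cD gB; have D0 : 0 <= D := le_trans (normr_ge0 _) cD.
have cD' := Lp_close_cst mU Uoo D0.
apply: (Lp_close_leD mU mg _ mg B0 D0 _ gB cD') => //.
move=> y _; rewrite subr0 (ger0_norm D0); apply: le_trans (lerD _ cD) => //.
rewrite -[leLHS]/(`|g y - c'|) (_ : g y - c' = (g y - c) + (c - c')).
  exact: ler_normD.
by ring.
Qed.

(** As [k] is trivial outside [W], the mass of [g] on [W] is spread over [V].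
    When [V] is much larger than [W] the factor [K] is small, and this gain is
    what makes large cells harmless for negative exponents. *)
Lemma Lp_close_restrict {V W k g c c' K M B} : measurable V -> measurable W ->
  measurable_fun V k -> measurable_fun W g -> 0 <= K -> 0 <= M -> 0 <= B ->
  fine (mu W) <= K `^ p * fine (mu V) ->
  (forall y, V y -> W y -> `|k y - c'| <= M * `|g y - c|) ->
  (forall y, V y -> ~ W y -> k y = c') ->
  Lp_close g W c B -> Lp_close k V c' (K * (M * B)).
Proof.
move=> mV mW mk mg K0 M0 B0 WV kg kc gB; rewrite /Lp_close.
have hp := p1; have mgW := measurable_powR_dist c mg.
have mMgW : measurable_fun W (fun y => (M `^ p)%:E * (`|g y - c| `^ p)%:E)%E.
  exact: measurable_funeM.
pose G := ((fun y => (M `^ p)%:E * (`|g y - c| `^ p)%:E) \_ W)%E.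
apply: (@le_trans _ _ (\int[mu]_(y in V) G y)%E).
  apply: ge0_le_integral => //.
  - exact: measurable_powR_dist.
  - apply: (@measurable_funS _ _ _ _ setT) => //.
    by apply/(measurable_restrictT _ mW).
  - move=> y Vy; rewrite /G patchE; case: ifPn => [|/negP]; rewrite inE => Wy.
      rewrite -EFinM lee_fin -powRM//; apply: ge0_ler_powR => //.
      - by rewrite nnegrE mulr_ge0.
      - exact: kg.
    by rewrite kc// subrr normr0 powR0//; lra.
rewrite -integral_mkcondr.
apply: (@le_trans _ _ 
  (\int[mu]_(y in W) ((M `^ p)%:E * (`|g y - c| `^ p)%:E))%E).
  apply: ge0_subset_integral => //; first exact: measurableI.
  by move=> y _; rewrite mule_ge0 ?lee_fin ?powR_ge0.
rewrite ge0_integralZl//; last by rewrite lee_fin powR_ge0.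
apply: (@le_trans _ _ ((M `^ p)%:E * (fine (mu W) * B `^ p)%:E)%E).
  by apply: lee_wpmul2l; rewrite ?lee_fin ?powR_ge0.
rewrite -EFinM lee_fin powRM ?mulr_ge0// [(M * B) `^ p]powRM//.
rewrite [leRHS](_ : _ = M `^ p * (K `^ p * fine (mu V) * B `^ p)); last by ring.
by rewrite ler_wpM2l ?powR_ge0// ler_wpM2r ?powR_ge0.
Qed.

Lemma Lp_close_le {U g k b c M B} : measurable U ->
  measurable_fun U g -> measurable_fun U k -> 0 <= M -> 0 <= B ->
  (forall y, U y -> `|k y - c| <= M * `|g y - b|) ->
  Lp_close g U b B -> Lp_close k U c (M * B).
Proof.
move=> mU mg mk M0 B0 kg gB; rewrite -[M * B]mul1r.
apply: (Lp_close_restrict mU mU mk mg _ M0 B0 _ _ _ gB) => // [|y Uy _].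
- by rewrite powR1 mul1r.
- exact: kg.
Qed.

Lemma Lp_close_eq {U g c B} : 0 <= B -> (forall y, U y -> g y = c) ->
  Lp_close g U c B.
Proof.
move=> B0 gc; have hp := p1.
rewrite /Lp_close integral0_eq ?lee_fin ?mulr_ge0 ?fine_ge0 ?powR_ge0//.
by move=> y Uy; rewrite gc// subrr normr0 powR0//; lra.
Qed.

(** The substitute for Jensen's inequality: [t] exceeds [e] only where
    [(t / e)^(p - 1) >= 1]. *)
Lemma ler_powR_affine (t e : R) : 0 <= t -> 0 < e ->
  t <= e + e `^ (1 - p) * t `^ p.
Proof.
have hp := p1.
move=> t0 e0; have [te|et] := leP t e.
  by rewrite -[leLHS]addr0 lerD// mulr_ge0 ?powR_ge0.
have tp : t `^ (p - 1) * t = t `^ p.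
  rewrite -[X in _ * X]powRr1// -powRD ?subrK//.
  by apply/implyP => _; rewrite gt_eqF//; lra.
have ep : 1 <= e `^ (1 - p) * t `^ (p - 1).
  rewrite -opprB powRN -[leLHS](@mulVf _ (e `^ (p - 1))) ?gt_eqF ?powR_gt0//.
  by rewrite ler_wpM2l ?invr_ge0 ?powR_ge0// ge0_ler_powR ?nnegrE; lra.
have : t <= e `^ (1 - p) * t `^ p.
  by rewrite -tp mulrA -[leLHS]mul1r ler_wpM2r.
lra.
Qed.

Lemma integrable_cst_lt_pinfty U c : measurable U -> (mu U < +oo)%E ->
  mu.-integrable U (EFin \o cst c).
Proof.
move=> mU Uoo; apply/integrableP; split; first exact/measurable_EFinP.
by rewrite (@integral_cst _ _ _ mu U mU `|c|%:E) lte_mul_pinfty.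
Qed.

Lemma integrable_powR_dist {U g c B} : measurable U -> measurable_fun U g ->
  Lp_close g U c B -> mu.-integrable U (fun y => (`|g y - c| `^ p)%:E).
Proof.
move=> mU mg gB; apply/integrableP; split; first exact: measurable_powR_dist.
under eq_integral do rewrite gee0_abs ?lee_fin ?powR_ge0//.
by apply: (le_lt_trans gB); rewrite ltry.
Qed.

Lemma Lp_close_integrable {U g c B} : measurable U -> (mu U < +oo)%E ->
  measurable_fun U g -> Lp_close g U c B ->
  mu.-integrable U (EFin \o g).
Proof.
move=> mU Uoo mg gB.
have ip := integrable_powR_dist mU mg gB.
have ic e : mu.-integrable U (EFin \o cst e).
  exact: integrable_cst_lt_pinfty.
apply: (le_integrable mU _ _ (integrableD mU (ic (`|c| + 1)) ip)).
  exact/measurable_EFinP.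
move=> y Uy; rewrite lee_fin [leRHS]ger0_norm ?addr_ge0 ?powR_ge0//.
have := ler_powR_affine (normr_ge0 (g y - c)) (@ltr01 R).
rewrite powR1 mul1r => h; have := ler_normD (g y - c) c; rewrite subrK /=; lra.
Qed.

(** Averaging [ler_powR_affine] for [t = |g - c|] gives [e + e^(1-p) B^p], which
    is at most [2 e] as soon as [B <= e]. *)
Lemma Lp_close_average {U g c B} : measurable U -> (0 < mu U < +oo)%E ->
  measurable_fun U g -> 0 <= B -> Lp_close g U c B ->
  `|(fine (mu U))^-1 * \int[mu]_(y in U) g y - c| <= 2 * B.
Proof.
move=> mU /andP[U0 Uoo] mg B0 gB.
have m0 : 0 < fine (mu U) by rewrite fine_gt0// U0.
have ig := Lp_close_integrable mU Uoo mg gB.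
have ic e : mu.-integrable U (EFin \o cst e).
  exact: integrable_cst_lt_pinfty.
have ip : mu.-integrable U (EFin \o (fun y => `|g y - c| `^ p)).
  exact: integrable_powR_dist gB.
have Ip : \int[mu]_(y in U) (`|g y - c| `^ p) <= fine (mu U) * B `^ p.
  by rewrite -lee_fin fineK// integrable_fin_num.
have igc : mu.-integrable U (EFin \o (fun y => g y - c)).
  exact: (integrableB mU ig (ic c)).
have avgE : (fine (mu U))^-1 * \int[mu]_(y in U) g y - c =
            (fine (mu U))^-1 * \int[mu]_(y in U) (g y - c).
  rewrite (RintegralB mU ig (ic c)) Rintegral_cst// mulrBr; congr (_ - _).
  by rewrite mulrCA mulVf ?mulr1// gt_eqF.
rewrite avgE normrM gtr0_norm ?invr_gt0// ler_pdivrMl//.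
(* [e = B] would be the natural choice, but [B] may be [0]. *)
apply/ler_addgt0Pr => z z0; pose e := B + z / (2 * fine (mu U)).
have z20 : 0 < z / (2 * fine (mu U)) by rewrite divr_gt0// mulr_gt0.
have e0 : 0 < e by rewrite /e; lra.
have ie : mu.-integrable U
    (EFin \o (fun y => e + e `^ (1 - p) * `|g y - c| `^ p)).
  exact: (integrableD mU (ic e) (integrableZl mU (e `^ (1 - p)) ip)).
apply: (le_trans (le_normr_Rintegral mU igc)).
apply: (@le_trans _ _
   (\int[mu]_(y in U) (e + e `^ (1 - p) * `|g y - c| `^ p))).
  apply: le_Rintegral => //; first exact: integrable_norm igc.
  by move=> y _; exact: ler_powR_affine.
rewrite (RintegralD mU (ic e) (integrableZl mU (e `^ (1 - p)) ip)).
rewrite Rintegral_cst// RintegralZl//.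
apply: (@le_trans _ _ (e * fine (mu U) +
   e `^ (1 - p) * (fine (mu U) * e `^ p))).
  rewrite lerD2l ler_wpM2l ?powR_ge0//; apply: (le_trans Ip).
  rewrite ler_wpM2l ?fine_ge0//; apply: ge0_ler_powR => //.
  - by rewrite nnegrE ltW.
  - by rewrite /e; lra.
rewrite mulrCA -powRD ?subrK ?powRr1 ?(ltW e0)//; last first.
  by rewrite gt_eqF// implybT.
rewrite /e (_ : _ + _ = fine (mu U) * (2 * B) + z)//; field.
by rewrite gt_eqF.
Qed.

End Lp_close.

(** * Geometry of cells *)

Section gauge.
Context (R : realType) (n : nat).
Implicit Types (x y z u : 'rV[R]_n) (a s t rho : R) (sh : cell_shape).

Lemma sqr_enorm x : enorm x ^+ 2 = \sum_(i < n) x 0 i ^+ 2.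
Proof. by rewrite sqr_sqrtr// sumr_ge0// => i _; exact: sqr_ge0. Qed.

Lemma enorm_ge0 x : 0 <= enorm x. Proof. exact: sqrtr_ge0. Qed.

Lemma enorm_le x s : 0 <= s ->
  \sum_(i < n) x 0 i ^+ 2 <= s ^+ 2 -> enorm x <= s.
Proof.
by move=> s0; rewrite -sqr_enorm ler_pXn2r// nnegrE enorm_ge0.
Qed.

(** Cauchy-Schwarz, from [2 a b <= (B/A) a^2 + (A/B) b^2] with [A] and [B]
    slightly larger than the norms, as the norms themselves may vanish. *)
Lemma sum_mul_le_enorm x y : \sum_(i < n) x 0 i * y 0 i <= enorm x * enorm y.
Proof.
apply/ler_addgt0Pr => e e0.
have [x0 y0] := (enorm_ge0 x, enorm_ge0 y).
pose d := Num.min 1 (e / (enorm x + enorm y + 1)).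
have d0 : 0 < d by rewrite lt_min ltr01 divr_gt0// ltr_wpDl// addr_ge0.
have d1 : d <= 1 by rewrite ge_min lexx.
have dE : d * (enorm x + enorm y + 1) <= e.
  by rewrite -ler_pdivlMr ?ge_min ?lexx ?orbT// ltr_wpDl// addr_ge0.
pose A := enorm x + d; pose B := enorm y + d.
have A0 : 0 < A by rewrite ltr_wpDl.
have B0 : 0 < B by rewrite ltr_wpDl.
apply: (@le_trans _ _ (A * B)); last by rewrite /A /B; nra.
have h (i : 'I_n) :
    x 0 i * y 0 i <= 2^-1 * (B / A * x 0 i ^+ 2 + A / B * y 0 i ^+ 2).
  have -> : 2^-1 * (B / A * x 0 i ^+ 2 + A / B * y 0 i ^+ 2) =
            x 0 i * y 0 i + (B * x 0 i - A * y 0 i) ^+ 2 / (2 * A * B).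
    by field; rewrite !gt_eqF.
  by rewrite lerDl divr_ge0 ?sqr_ge0// ltW// !mulr_gt0.
apply: (le_trans (ler_sum _ (fun i _ => h i))).
rewrite -mulr_sumr big_split/= -!mulr_sumr -!sqr_enorm.
rewrite ler_pdivrMl//.
have hx : B / A * enorm x ^+ 2 <= A * B.
  rewrite -mulrA [leRHS]mulrC ler_pM2l//.
  rewrite mulrC ler_pdivrMr// -expr2 ler_pXn2r ?nnegrE// ?ltW//.
  by rewrite ltrDl.
have hy : A / B * enorm y ^+ 2 <= A * B.
  rewrite -mulrA ler_pM2l// mulrC ler_pdivrMr// -expr2.
  by rewrite ler_pXn2r ?nnegrE// ?ltW// ltrDl.
by lra.
Qed.

Lemma enormD x y : enorm (x + y) <= enorm x + enorm y.
Proof.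
apply: enorm_le; first by rewrite addr_ge0 ?enorm_ge0.
under eq_bigr do rewrite mxE sqrrD.
rewrite !big_split/= -!sqr_enorm sqrrD lerD2r lerD2l mulr2n.
by rewrite lerD// sum_mul_le_enorm.
Qed.

Lemma normr_coord_gauge sh x i : `|x 0 i| <= gauge sh x.
Proof.
case: sh => /=; first exact: (le_bigmax_cond _ (fun i => `|x 0 i|)).
rewrite -(ler_pXn2r (ltn0Sn 1)) ?nnegrE ?enorm_ge0// sqr_enorm.
rewrite real_normK ?num_real// (bigD1 i)//= lerDl sumr_ge0// => j _.
exact: sqr_ge0.
Qed.

Lemma gauge_ge0 sh x : 0 <= gauge sh x.
Proof.
by case: sh => /=; [exact: bigmax_ge_id|exact: enorm_ge0].
Qed.

Lemma gaugeZ sh a x : gauge sh (a *: x) = `|a| * gauge sh x.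
Proof.
case: sh => /=.
  elim/big_rec2: _ => [|i u v _ ->].

    by rewrite mulr0.
  by rewrite mxE normrM maxr_pMr.
rewrite /enorm; under eq_bigr do rewrite mxE exprMn.
by rewrite -mulr_sumr sqrtrM ?sqr_ge0// sqrtr_sqr.
Qed.

Lemma gauge0 sh : gauge sh (0 : 'rV[R]_n) = 0.
Proof. by rewrite -(scale0r (0 : 'rV[R]_n)) gaugeZ normr0 mul0r. Qed.

Lemma gaugeN sh x : gauge sh (- x) = gauge sh x.
Proof. by rewrite -scaleN1r gaugeZ normrN1 mul1r. Qed.

Lemma gauge_distC sh x y : gauge sh (x - y) = gauge sh (y - x).
Proof. by rewrite -gaugeN opprB. Qed.

Lemma gaugeD sh x y : gauge sh (x + y) <= gauge sh x + gauge sh y.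
Proof.
case: sh => /=; last exact: enormD.
apply: bigmax_le => [|i _].
  by rewrite addr_ge0// (gauge_ge0 Cube).
rewrite mxE; apply: le_trans (ler_normD _ _) _.
by rewrite lerD// (normr_coord_gauge Cube).
Qed.

Lemma gauge0_eq0 sh x : gauge sh x = 0 -> x = 0.
Proof.
move=> x0; apply/rowP => i; rewrite mxE; apply/eqP.
by rewrite -normr_le0 -x0 normr_coord_gauge.
Qed.

Lemma enorm_gt0 x : x != 0 -> 0 < enorm x.
Proof.
move=> x0; rewrite lt_def enorm_ge0 andbT; apply: contra_neq x0.
exact: (@gauge0_eq0 Ball).
Qed.

Lemma gauge_le_enorm sh x : gauge sh x <= enorm x.
Proof.
case: sh => //=; apply: bigmax_le => [|i _]; first exact: enorm_ge0.
exact: (normr_coord_gauge Ball).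
Qed.

Lemma enorm_le_sum x : enorm x <= \sum_(i < n) `|x 0 i|.
Proof.
apply: enorm_le; first by rewrite sumr_ge0.
rewrite expr2 mulr_suml ler_sum// => i _.
rewrite -[x 0 i ^+ 2]real_normK ?num_real// expr2 ler_wpM2l//.
by rewrite (bigD1 i)//= lerDl sumr_ge0.
Qed.

Lemma enorm_le_gauge sh x : enorm x <= n%:R * gauge sh x.
Proof.
apply: (le_trans (enorm_le_sum x)).
rewrite -[X in X%:R]card_ord -sum1_card natr_sum mulr_suml ler_sum// => i _.
by rewrite mul1r normr_coord_gauge.
Qed.

Lemma Qat_E sh x s : Qat sh x s = [set z | gauge sh (z - x) < s].
Proof.
apply/seteqP; split => [_ [y Qy <-]|z zs]/=; first by rewrite addrC addKr.
by exists (z - x) => //; rewrite addrC subrK.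
Qed.

Lemma Qat0 sh s : Qat sh (0 : 'rV[R]_n) s = Q sh s.
Proof. by rewrite Qat_E; apply/seteqP; split => z /=; rewrite subr0. Qed.

Lemma subset_Qat sh x y s t : gauge sh (x - y) + s <= t ->
  Qat sh x s `<=` Qat sh y t.
Proof.
move=> xyst z; rewrite !Qat_E/= => zx.
have -> : z - y = (z - x) + (x - y) by rewrite addrA subrK.
by apply: le_lt_trans (gaugeD _ _ _) _; lra.
Qed.

Lemma subset_Q sh s t : s <= t -> (Q sh s : set 'rV[R]_n) `<=` Q sh t.
Proof. by move=> st x /lt_le_trans; exact. Qed.

(** Doubling around the same centre could leave [Q_rho].  The cell used instead
    is the convex combination [(1 - a) Q(x,s) + a Q_rho] whose radius is [2 s]:
    it stays in [Q_rho] by convexity, and contains [Q(x,s)] because [Q_rho]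
    does. *)
Lemma double_cell sh x s rho : 0 < s -> 2 * s <= rho -> gauge sh x + s <= rho ->
  exists y, Qat sh x s `<=` Qat sh y (2 * s) /\ gauge sh y + 2 * s <= rho.
Proof.
move=> s0 srho xs; pose a := s / (rho - s).
have rs : 0 < rho - s by lra.
have aE : a * (rho - s) = s by rewrite divfK// gt_eqF.
have a0 : 0 <= a by rewrite divr_ge0; lra.
have a1 : a <= 1 by rewrite ler_pdivrMr//; lra.
have x0 := gauge_ge0 sh x.
exists ((1 - a) *: x); split.
  apply: subset_Qat.
  rewrite -[X in X - _]scale1r -scalerBl opprB addrCA subrr addr0 gaugeZ.
  rewrite ger0_norm//.
  nra.
rewrite gaugeZ ger0_norm; last lra.
nra.
Qed.

End gauge.

(** * Lebesgue measure of cells *)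

Section borel.
Context (R : realType) (n : nat).
Implicit Types (x y z : 'rV[R]_n) (s : R).

Lemma measurable_enormB x :
  measurable_fun [set: 'rV[R]_n] (fun z => enorm (z - x) : measurableTypeR R).
Proof.
apply: (@measurableT_comp _ _ _ _ _ _ (@Num.sqrt R)).
  exact: continuous_measurable_fun (@sqrt_continuous R).
apply: (eq_measurable_fun (fun z => \sum_(i < n) (z 0 i - x 0 i) ^+ 2)).
  by move=> z _; apply: eq_bigr => i _; rewrite !mxE.
apply: measurable_sum => i; apply: measurable_funX.
by apply: measurable_funB => //; exact: measurable_coor.
Qed.

Lemma rat_rV_dense x s : 0 < s ->
  exists q : 'rV[rat]_n, enorm (x - map_mx ratr q) < s.
Proof.
move=> s0; pose e := s / (n.+1)%:R.
have e0 : 0 < e by rewrite divr_gt0.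
have h (i : 'I_n) : exists q : rat, `|x 0 i - ratr q| <= e.
  have [|q] := @rat_in_itvoo _ (x 0 i - e) (x 0 i + e); first lra.
  rewrite in_itv/= => /andP[q1 q2]; exists q.
  by rewrite ler_norml; apply/andP; split; lra.
have [q qe] := boolp.choice h.
exists (\row_i q i); apply: le_lt_trans (enorm_le_sum _) _.
apply: (@le_lt_trans _ _ (\sum_(i < n) e)).
  by apply: ler_sum => i _; rewrite !mxE.
rewrite sumr_const card_ord -mulr_natl mulrCA -[ltRHS]mulr1 ltr_pM2l//.
by rewrite ltr_pdivrMr// mul1r ltr_nat.
Qed.

(** The sigma-algebra on [R^n] is generated by the coordinates, so continuity
    is not directly usable.  Each sublevel set of [g] is the union, over the
    rational points [q], of the sublevel sets of the cones
    [g q + |z - q|] above [g]. *)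
Lemma measurable_lipschitz (g : 'rV[R]_n -> R) :
  (forall x y, `|g x - g y| <= enorm (x - y)) ->
  measurable_fun [set: 'rV[R]_n] (g : _ -> measurableTypeR R).
Proof.
move=> gL; apply: (measurability _ (RGenInftyO.measurableE R)).
move=> _ [_ [a ->] <-]; rewrite setTI.
pose F (q : 'rV[rat]_n) : set 'rV[R]_n :=
  [set z | g (map_mx ratr q) + enorm (z - map_mx ratr q) < a].
rewrite (_ : _ @^-1` _ = \bigcup_q F q).
  apply: countable_bigcupT_measurable => [|q].
    exact: countableP.
  have mF : measurable_fun [set: 'rV[R]_n] (fun z : 'rV[R]_n =>
      g (map_mx ratr q) + enorm (z - map_mx ratr q) : measurableTypeR R).
    by apply: measurable_funD => //; exact: measurable_enormB.
  have := mF measurableT _ (measurable_itv `]-oo, a[).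
  by rewrite setTI.
apply/seteqP; split => [z /=|z [q _]]; rewrite ?in_itv/=.
  move=> gza; have [q qz] := @rat_rV_dense z ((a - g z) / 2) ltac:(lra).
  exists q => //; rewrite /F/=.
  have := gL z (map_mx ratr q).
  by rewrite ler_norml => /andP[]; lra.
rewrite /F/= => gqa; have := gL z (map_mx ratr q).
by rewrite in_itv/= ler_norml => /andP[_]; lra.
Qed.

Lemma gauge_sub_le_enorm sh x y : `|gauge sh x - gauge sh y| <= enorm (x - y).
Proof.
apply: le_trans (gauge_le_enorm sh _).
have h1 := gaugeD sh (x - y) y; have h2 := gaugeD sh (y - x) x.
rewrite !subrK in h1 h2; rewrite gauge_distC in h2.
by rewrite ler_norml; apply/andP; split; lra.
Qed.

Lemma measurable_Qat_borel sh x s : measurable (Qat sh x s).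
Proof.
have mg : measurable_fun [set: 'rV[R]_n]
    (fun z => gauge sh (z - x) : measurableTypeR R).
  apply: measurable_lipschitz => y z.
  apply: le_trans (gauge_sub_le_enorm _ _ _) _.
  by rewrite opprB addrA subrK.
have := mg measurableT _ (measurable_itv `]-oo, s[).
rewrite setTI; set B := (X in measurable X) => mB.
rewrite (_ : Qat sh x s = B)//.
by rewrite Qat_E; apply/seteqP; split => z; rewrite /B/= in_itv.
Qed.

Lemma measurable_borel (A : set 'rV[R]_n) : measurable A ->
  measurable (A : set (lebesgue_space R n)).
Proof. exact: caratheodory_measurable_mu_ext. Qed.

Lemma measurable_fun_borel (g : 'rV[R]_n -> R) :
  measurable_fun [set: 'rV[R]_n] (g : _ -> measurableTypeR R) ->
  measurable_fun [set: lebesgue_space R n] g.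
Proof.
move=> mg _ B mB; rewrite setTI; apply: measurable_borel.
by rewrite -[X in measurable X]setTI; exact: mg.
Qed.

Lemma lebesgue_rV_borel (A : set 'rV[R]_n) : measurable A ->
  lebesgue_rV R n A = borel_lebesgue_rV R n A.
Proof. exact: measurable_mu_extE. Qed.

End borel.

Section box.
Context (R : realType).

(** These are the open cubes; the coordinatewise form is the one that splits
    along the inductive definition of the measure. *)
Definition box n (x : 'rV[R]_n) (s : R) : set 'rV[R]_n :=
  [set y | forall i, `|y 0 i - x 0 i| < s].

Lemma box_Qat_Cube n (x : 'rV[R]_n) s : 0 < s -> box x s = Qat Cube x s.
Proof.
move=> s0; rewrite Qat_E; apply/seteqP; split => y /=.
  move=> yx; apply/bigmax_ltP; split => // i _; by rewrite !mxE.
move=> yx i; have := normr_coord_gauge Cube (y - x) i.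
by rewrite !mxE => /le_lt_trans; apply.
Qed.

Lemma measurable_box n (x : 'rV[R]_n) s : 0 < s -> measurable (box x s).
Proof. by move=> s0; rewrite box_Qat_Cube//; exact: measurable_Qat_borel. Qed.

Lemma cons_rV_preimage_box n (x : 'rV[R]_n.+1) s :
  @cons_rV R n @^-1` box x s =
  `]x 0 ord0 - s, x 0 ord0 + s[%classic `*` box (uncons_rV x).2 s.
Proof.
have x0E : forall (v : 'rV[R]_n.+1) (j : 'I_n),
    (uncons_rV v).2 0 j = v 0 (lift ord0 j).
  by move=> v j; rewrite /= mxE; congr (v 0 _); exact: val_inj.
have c0E : forall a (y : 'rV[R]_n), cons_rV (a, y) 0 ord0 = a.
  by move=> a y; have := congr1 fst (cons_rVK (a, y)).
have cSE : forall a (y : 'rV[R]_n) j, cons_rV (a, y) 0 (lift ord0 j) = y 0 j.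
  by move=> a y j; rewrite -x0E cons_rVK.
apply/seteqP; split => -[a y] /=.
  move=> h; split => /=.
    have := h ord0; rewrite c0E in_itv/= ltr_norml => /andP[? ?].
    by apply/andP; split; lra.
  by move=> j; have := h (lift ord0 j); rewrite cSE -x0E.
rewrite in_itv/= => -[/andP[h1 h2] h] i.
have [j ->|->] := unliftP ord0 i; first by rewrite cSE -x0E.
by rewrite c0E ltr_norml; apply/andP; split; lra.
Qed.

Lemma borel_lebesgue_rV_box n (x : 'rV[R]_n) s : 0 < s ->
  borel_lebesgue_rV R n (box x s) = ((2 * s) ^+ n)%:E.
Proof.
move=> s0; elim: n x => [|n IH] x.
  by rewrite /= diracE mem_set// => -[].
rewrite [LHS](_ : _ = (@lebesgue_measure R \x borel_lebesgue_rV R n)%E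
  (@cons_rV R n @^-1` box x s))//.
rewrite cons_rV_preimage_box product_measure1E//; last exact: measurable_box.
have lI : @lebesgue_measure R `]x 0 ord0 - s, x 0 ord0 + s[%classic =
    (2 * s)%:E.
  rewrite lebesgue_measure_itv/= lte_fin ifT; last lra.
  by rewrite -EFinB; congr (_%:E); lra.
by rewrite IH exprS EFinM -lI.
Qed.

End box.

Section cell.
Context (R : realType) (n : nat) (sh : cell_shape).
Implicit Types (x : 'rV[R]_n) (s : R).

Lemma measurable_Qat x s : measurable (Qat sh x s : set (lebesgue_space R n)).
Proof. by apply: measurable_borel; exact: measurable_Qat_borel. Qed.

Lemma lebesgue_rV_Qat_le x s : 0 < s ->
  (lebesgue_rV R n (Qat sh x s) <= ((2 * s) ^+ n)%:E)%E.
Proof.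
move=> s0; rewrite lebesgue_rV_borel; last exact: measurable_Qat_borel.
rewrite -(borel_lebesgue_rV_box x s0); apply: le_measure.
- by rewrite inE; exact: measurable_Qat_borel.
- by rewrite inE; exact: measurable_box.
- rewrite Qat_E => y /= yx i; have := normr_coord_gauge sh (y - x) i.
  by rewrite !mxE => /le_lt_trans; apply.
Qed.

Lemma lebesgue_rV_Qat_ge x s : (0 < n)%N -> 0 < s ->
  (((2 * s / n%:R) ^+ n)%:E <= lebesgue_rV R n (Qat sh x s))%E.
Proof.
move=> n0 s0; rewrite lebesgue_rV_borel; last exact: measurable_Qat_borel.
have sn0 : 0 < s / n%:R by rewrite divr_gt0// ltr0n.
rewrite -mulrA -(borel_lebesgue_rV_box x sn0); apply: le_measure.
- by rewrite inE; exact: measurable_box.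
- by rewrite inE; exact: measurable_Qat_borel.
- rewrite Qat_E => y /= yx; apply: le_lt_trans (gauge_le_enorm _ _) _.
  apply: le_lt_trans (enorm_le_sum _) _.
  apply: (@lt_le_trans _ _ (\sum_(i < n) s / n%:R)).
    apply: ltr_sum => [|i _]; last by rewrite !mxE.
    by apply/hasP; exists (Ordinal n0); rewrite ?mem_index_enum.
  rewrite sumr_const card_ord -[leLHS]mulr_natl mulrCA.
  by rewrite mulfV ?mulr1// pnatr_eq0 -lt0n.
Qed.

Lemma lebesgue_rV_Qat_gt0 x s : (0 < n)%N -> 0 < s ->
  (0 < lebesgue_rV R n (Qat sh x s) < +oo)%E.
Proof.
move=> n0 s0; apply/andP; split.
  apply: lt_le_trans (lebesgue_rV_Qat_ge x n0 s0).
  by rewrite lte_fin exprn_gt0// divr_gt0 ?mulr_gt0// ltr0n.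
by apply: le_lt_trans (lebesgue_rV_Qat_le x s0) _; rewrite ltry.
Qed.

(** In the form required by [Lp_close_restrict].  The ratio of the measures is
    [(t / s)^n] up to a factor, which the two boxes around each
    cell give as [n^n]. *)
Lemma lebesgue_rV_Qat_ratio x y s t (p : R) : (0 < n)%N -> 1 <= p ->
  0 < s -> 0 < t ->
  fine (lebesgue_rV R n (Qat sh y t)) <=
  ((n%:R * t / s) `^ (n%:R / p)) `^ p * fine (lebesgue_rV R n (Qat sh x s)).
Proof.
move=> n0 p1 s0 t0; have nR0 : 0 < n%:R :> R by rewrite ltr0n.
have fQ z u : 0 < u -> lebesgue_rV R n (Qat sh z u) \is a fin_num.
  move=> u0; have /andP[h1 h2] := lebesgue_rV_Qat_gt0 z n0 u0.
  by rewrite ge0_fin_numE// ltW.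
rewrite -powRrM divfK ?gt_eqF//; last lra.
rewrite powR_mulrn; last by rewrite divr_ge0 ?mulr_ge0// ltW.
apply: (@le_trans _ _ ((2 * t) ^+ n)).
  by rewrite -lee_fin fineK ?fQ// lebesgue_rV_Qat_le.
apply: (@le_trans _ _ ((n%:R * t / s) ^+ n * (2 * s / n%:R) ^+ n)).
  rewrite -exprMn le_eqVlt; apply/orP; left; apply/eqP; congr (_ ^+ _).
  by field; rewrite !gt_eqF.
rewrite ler_wpM2l ?exprn_ge0//; first by rewrite divr_ge0 ?mulr_ge0// ltW.
by rewrite -lee_fin fineK ?fQ// lebesgue_rV_Qat_ge.
Qed.

End cell.

(** * Campanato norms and closeness to constants on cells *)

Section campanato_norm.
Context (R : realType) (n : nat) (sh : cell_shape) (p lam : R).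
Hypotheses (n_gt0 : (0 < n)%N) (p1 : 1 <= p).
Implicit Types (x y : 'rV[R]_n) (s t rho N : R).
Implicit Types (f g : lebesgue_space R n -> R) (U : set 'rV[R]_n).

Let mu := lebesgue_rV R n.

Lemma mean_oscillation_leP f U B : (0 < mu U < +oo)%E -> 0 <= B ->
  ((mean_oscillation p f U <= B%:E)%E <->
   Lp_close mu p f U (average f U) B).
Proof.
move=> /andP[U0 Uoo] B0; have hp := p1.
have m0 : 0 < fine (mu U) by rewrite fine_gt0// U0.
have p0 : p != 0 by rewrite gt_eqF//; lra.
rewrite /mean_oscillation /Lp_close -/mu EFinM -lee_pdivrMl//.
set X := (X in poweR X _); rewrite -[X in _ <-> (X <= _)%E]/X.
have X0 : (0 <= X)%E.
  rewrite mule_ge0 ?lee_fin ?invr_ge0 ?fine_ge0//.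
  by apply: integral_ge0 => y _; rewrite lee_fin powR_ge0.
have itv0 (Y : \bar R) : (0 <= Y)%E -> Y \in `[0%E, +oo%E].
  by move=> Y0; rewrite in_itv/= Y0 leey.
split => XB.
  rewrite -poweR_EFin -[leLHS]poweRe1// -(mulVf p0) poweRrM.
  by apply: gt0_ler_poweR; rewrite ?itv0 ?poweR_ge0 ?lee_fin//; lra.
rewrite -[B]powRr1// -(mulfV p0) powRrM -poweR_EFin.
by apply: gt0_ler_poweR; rewrite ?itv0 ?invr_ge0 ?lee_fin ?powR_ge0//; lra.
Qed.

Lemma campanato_norm_ge0 t f : 0 < t ->
  (0 <= campanato_norm sh p lam (Q sh t) f)%E.
Proof.
move=> t0; apply: (@le_trans _ _
    (((t `^ lam)^-1)%:E * mean_oscillation p f (Qat sh 0 t))%E).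
  by rewrite mule_ge0 ?poweR_ge0// lee_fin invr_ge0 powR_ge0.
apply: ereal_sup_ubound; exists 0, t; split => //.
by rewrite Qat0.
Qed.

Lemma campanato_norm_subset U V f : U `<=` V ->
  (campanato_norm sh p lam U f <= campanato_norm sh p lam V f)%E.
Proof.
move=> UV; apply: ge_ereal_sup => _ [x [s [s0 xsU ->]]].
by apply: ereal_sup_ubound; exists x, s; split => //; apply: subset_trans UV.
Qed.

Lemma Lp_close_cell x s U f N : 0 < s -> 0 <= N -> Qat sh x s `<=` U ->
  (campanato_norm sh p lam U f <= N%:E)%E ->
  Lp_close mu p f (Qat sh x s) (average f (Qat sh x s)) (N * s `^ lam).
Proof.
move=> s0 N0 xsU fN; have Q0 := lebesgue_rV_Qat_gt0 sh x n_gt0 s0.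
have Ns0 : 0 <= N * s `^ lam by rewrite mulr_ge0 ?powR_ge0.
apply/(mean_oscillation_leP f Q0 Ns0).
rewrite EFinM muleC -lee_pdivrMl ?powR_gt0//.
by apply: le_trans fN; apply: ereal_sup_ubound; exists x, s; split.
Qed.

(** If [g] is within [b] of some constant on a cell, its average there is within
    [2 b] of that constant, so [g] is within [4 (b + 2 b)] of its average. *)
Lemma campanato_norm_le U g B : measurable_fun [set: lebesgue_space R n] g ->
  0 <= B ->
  (forall x s, 0 < s -> Qat sh x s `<=` U ->
    exists c, Lp_close mu p g (Qat sh x s) c (B * s `^ lam)) ->
  (campanato_norm sh p lam U g <= (12 * B)%:E)%E.
Proof.
move=> mg B0 gB; apply: ge_ereal_sup => _ [x [s [s0 xsU ->]]].
have [c gc] := gB _ _ s0 xsU.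
have mQ := measurable_Qat sh x s.
have Q0 := lebesgue_rV_Qat_gt0 sh x n_gt0 s0.
have mgQ : measurable_fun (Qat sh x s : set (lebesgue_space R n)) g.
  exact: measurable_funTS.
have Bs0 : 0 <= B * s `^ lam by rewrite mulr_ge0 ?powR_ge0.
have avg := Lp_close_average p1 mQ Q0 mgQ Bs0 gc.
rewrite lee_pdivrMl ?powR_gt0// -EFinM.
have Bs12 : 0 <= s `^ lam * (12 * B) by rewrite !mulr_ge0 ?powR_ge0.
apply/(mean_oscillation_leP g Q0 Bs12).
rewrite (_ : s `^ lam * (12 * B) =
  4 * (B * s `^ lam + 2 * (B * s `^ lam))); last by ring.
case/andP: Q0 => _ Qoo.
apply: (Lp_close_shift p1 mQ Qoo mgQ Bs0 _ gc).
by rewrite distrC.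
Qed.

End campanato_norm.

(** * Averages over nested cells *)

Lemma powR_pred (R : realType) (s lam : R) : 0 < s ->
  s `^ lam = s * s `^ (lam - 1).
Proof.
move=> s0; rewrite -[in LHS](subrKC 1 lam) (@powRD _ s 1) ?powRr1 ?ltW//.
by apply/implyP => _; rewrite gt_eqF.
Qed.

Lemma powR_antimono (R : realType) (s t e : R) : 0 < s -> s <= t -> e <= 0 ->
  t `^ e <= s `^ e.
Proof.
move=> s0 st e0; have t0 : 0 < t by lra.
have [d d0 ->] : exists2 d, 0 <= d & e = - d by exists (- e); lra.
rewrite !powRN lef_pV2 ?posrE ?powR_gt0//.
by apply: ge0_ler_powR; rewrite ?nnegrE; lra.
Qed.

Section averages.
Context (R : realType) (n : nat) (sh : cell_shape) (p lam : R).
Hypotheses (n_gt0 : (0 < n)%N) (p1 : 1 <= p) (lam1 : lam <= 1).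
Implicit Types (x y : 'rV[R]_n) (s t rho N : R).
Implicit Types (f g : lebesgue_space R n -> R).

Let mu := lebesgue_rV R n.

(** The [p]-th root of the ratio of measures in [lebesgue_rV_Qat_ratio] for two
    cells whose radii differ by a factor at most [2]. *)
Definition doubling_const : R := (2 * n%:R) `^ (n%:R / p).

Lemma average_subcell f x y s t N U :
  measurable_fun [set: lebesgue_space R n] f ->
  0 < s -> s <= t -> t <= 2 * s -> 0 <= N ->
  Qat sh x s `<=` Qat sh y t -> Qat sh y t `<=` U ->
  (campanato_norm sh p lam U f <= N%:E)%E ->
  `|average f (Qat sh x s) - average f (Qat sh y t)| <=
    2 * (doubling_const * (N * t `^ lam)).
Proof.
move=> mf s0 st t2s N0 xy yU fN; have hp := p1; have t0 : 0 < t by lra.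
have nR0 : 0 < n%:R :> R by rewrite ltr0n.
have K0 : 0 <= (n%:R * t / s) `^ (n%:R / p) by exact: powR_ge0.
have Nt0 : 0 <= N * t `^ lam by rewrite mulr_ge0 ?powR_ge0.
have := Lp_close_cell n_gt0 p1 t0 N0 yU fN.
move=> /(Lp_close_restrict p1 (measurable_Qat sh x s) (measurable_Qat sh y t)
  (measurable_funTS mf) (measurable_funTS mf) K0 ler01 Nt0
  (lebesgue_rV_Qat_ratio sh x y n_gt0 p1 s0 t0)).
move=> /(_ (average f (Qat sh y t))) close.
have /(Lp_close_average p1 (measurable_Qat sh x s)
    (lebesgue_rV_Qat_gt0 sh x n_gt0 s0) (measurable_funTS mf)) :
  Lp_close mu p f (Qat sh x s) (average f (Qat sh y t))
    ((n%:R * t / s) `^ (n%:R / p) * (1 * (N * t `^ lam))).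
  by apply: close => [z _ _|z /xy]; rewrite ?mul1r.
rewrite mulr_ge0 ?mul1r// => /(_ isT) /le_trans; apply.
rewrite ler_pM2l// ler_wpM2r//; apply: ge0_ler_powR.
- by rewrite divr_ge0//; lra.
- by rewrite nnegrE divr_ge0 ?mulr_ge0; lra.
- by rewrite nnegrE; lra.
- by rewrite ler_pdivrMr//; nra.
Qed.

(** Telescoping along cells of radius [s], [2 s], [4 s] and so on.  The factor
    [2 rho - s] is what makes the induction close when [lam = 1]: it decreases
    by [s] when [s] is doubled, and this pays for one step, whereas a bound by
    [rho s^(lam-1)] alone would not improve.  That it is at least [rho] on the
    whole range covers the last step. *)
Lemma average_chain f x s rho N : measurable_fun [set: lebesgue_space R n] f ->
  0 < s -> gauge sh x + s <= rho -> 0 <= N ->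
  (campanato_norm sh p lam (Q sh rho) f <= N%:E)%E ->
  `|average f (Qat sh x s) - average f (Q sh rho)| <=
    4 * doubling_const * (2 * rho - s) * s `^ (lam - 1) * N.
Proof.
move=> mf s0 xs N0 fN; have l1 := lam1.
have D0 : 0 <= doubling_const by exact: powR_ge0.
have [k sk] : exists k, rho <= 2 ^+ k * s.
  exists (Num.bound (rho / s)); rewrite -ler_pdivrMr//.
  have [|rs0] := leP (rho / s) 0.
    by move=> /le_trans; apply; rewrite exprn_ge0.
  apply: le_trans (ltW (archi_boundP (ltW rs0))) _.
  by rewrite -natrX ler_nat ltnW// ltn_expl.
elim: k x s s0 xs sk => [|k IH] x s s0 xs sk; have g0 := gauge_ge0 sh x;
    have sl0 : 0 < s `^ (lam - 1) by rewrite powR_gt0.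
  rewrite expr0 mul1r in sk.
  have srho : s = rho by lra.
  have x0 : x = 0 by apply: (@gauge0_eq0 _ _ sh); lra.
  rewrite x0 srho Qat0 subrr normr0 !mulr_ge0 ?powR_ge0//; lra.
have [rho2s|srho] := leP rho (2 * s).
  have base : `|average f (Qat sh x s) - average f (Q sh rho)| <=
      2 * (doubling_const * (N * rho `^ lam)).
    rewrite -Qat0; apply: (average_subcell (U := Q sh rho)) => //; first lra.
    - by apply: subset_Qat; rewrite subr0.
    - by rewrite Qat0.
  apply: (le_trans base).
  have rl : rho `^ lam <= rho * s `^ (lam - 1).
    rewrite powR_pred; last lra.
    by rewrite ler_pM2l ?powR_antimono; lra.
  have DN0 : 0 <= doubling_const * N by rewrite mulr_ge0.
  have h1 : rho * s `^ (lam - 1) <= (2 * rho - s) * s `^ (lam - 1).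
    by rewrite ler_pM2r//; lra.
  have h2 : 0 <= (2 * rho - s) * s `^ (lam - 1) by rewrite mulr_ge0//; lra.
  have h3 : rho `^ lam <= 2 * ((2 * rho - s) * s `^ (lam - 1)) by lra.
  have := ler_wpM2l DN0 h3; lra.
have [y [xy ys]] := double_cell s0 (ltW srho) xs.
have s20 : 0 < 2 * s by lra.
have sk' : rho <= 2 ^+ k * (2 * s) by rewrite mulrA -exprSr.
have far := IH y (2 * s) s20 ys sk'.
have near : `|average f (Qat sh x s) - average f (Qat sh y (2 * s))| <=
    2 * (doubling_const * (N * (2 * s) `^ lam)).
  apply: (average_subcell (U := Q sh rho)) => //; first lra.
  by rewrite -Qat0; apply: subset_Qat; rewrite subr0.
have sl : (2 * s) `^ (lam - 1) <= s `^ (lam - 1) by apply: powR_antimono; lra.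
have s2l : (2 * s) `^ lam <= 2 * s * s `^ (lam - 1).
  by rewrite powR_pred// ler_pM2l.
have DN0 : 0 <= doubling_const * N by rewrite mulr_ge0.
have h1 : (2 * rho - 2 * s) * (2 * s) `^ (lam - 1) <=
          (2 * rho - 2 * s) * s `^ (lam - 1) by rewrite ler_wpM2l//; lra.
have h1' := ler_wpM2l DN0 h1; have h2' := ler_wpM2l DN0 s2l.
rewrite (_ : average f (Qat sh x s) - average f (Q sh rho) =
  (average f (Qat sh x s) - average f (Qat sh y (2 * s))) +
  (average f (Qat sh y (2 * s)) - average f (Q sh rho))); last by ring.
apply: le_trans (ler_normD _ _) _; lra.
Qed.

End averages.

(** * Cutoff functions *)

Section cutoff.
Context (R : realType) (n : nat) (sh : cell_shape).
Implicit Types (x y : 'rV[R]_n) (h : 'rV[R]_n -> R).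

Lemma lip1_norm_le1P h :
  (lip1_norm h <= 1)%E <-> (forall x y, `|h x - h y| <= enorm (x - y)).
Proof.
split => [hL x y|hL].
  have [->|xy] := eqVneq x y; first by rewrite !subrr normr0 enorm_ge0.
  have e0 : 0 < enorm (x - y) by rewrite enorm_gt0// subr_eq0.
  have : ((`|h x - h y| / enorm (x - y))%:E <= 1)%E.
    by apply: le_trans hL; apply: ereal_sup_ubound; exists x, y.
  by rewrite lee_fin ler_pdivrMr// mul1r.
apply: ge_ereal_sup => _ [x [y [xy ->]]].
have e0 : 0 < enorm (x - y) by rewrite enorm_gt0// subr_eq0.
by rewrite lee_fin ler_pdivrMr// mul1r.
Qed.

Lemma cutoff_exists : exists h, cutoff sh h.
Proof.
pose h x := Num.max 0 (Num.min 1 (2 - gauge sh x)); exists h; split.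
- by move=> x x1; rewrite /h (min_idPl _) ?(max_idPr _)//; lra.
- by move=> x x2; rewrite /h (max_idPl _)// ge_min; apply/orP; right; lra.
- apply/lip1_norm_le1P => x y; apply: le_trans (gauge_sub_le_enorm sh _ _).
  rewrite /h; move: (gauge sh x) (gauge sh y) => a b.
  have h1 := ler_norm (a - b); have h2 := ler_norm (b - a).
  rewrite [`|b - a|]distrC in h2; rewrite ler_norml.
  have [] := leP 1 (2 - a) => ha1; have [] := leP 1 (2 - b) => hb1;
    rewrite ?(max_idPr ler01); have [] := leP 0 (2 - a) => ha0;
    have [] := leP 0 (2 - b) => hb0; apply/andP; split; lra.
Qed.

Section dilated_cutoff.
Variables (h : 'rV[R]_n -> R) (r : R).
Hypotheses (ch : cutoff sh h) (r0 : 0 < r).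

Lemma gauge_dilate x : gauge sh (r^-1 *: x) = gauge sh x / r.
Proof. by rewrite gaugeZ gtr0_norm ?invr_gt0// mulrC. Qed.

Lemma dilated_cutoff_eq1 x : gauge sh x <= r -> h (r^-1 *: x) = 1.
Proof.
by case: ch => h1 _ _ xr; apply: h1; rewrite gauge_dilate ler_pdivrMr// mul1r.
Qed.

Lemma dilated_cutoff_eq0 x : 2 * r <= gauge sh x -> h (r^-1 *: x) = 0.
Proof.
by case: ch => _ h0 _ xr; apply: h0; rewrite gauge_dilate ler_pdivlMr.
Qed.

Lemma cutoff_lipschitz x y : `|h x - h y| <= enorm (x - y).
Proof. by case: ch => _ _ /lip1_norm_le1P. Qed.

Lemma dilated_cutoff_lipschitz x y :
  `|h (r^-1 *: x) - h (r^-1 *: y)| <= n%:R * gauge sh (x - y) / r.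
Proof.
apply: le_trans (cutoff_lipschitz _ _) _.
by rewrite -scalerBr -mulrA -gauge_dilate enorm_le_gauge.
Qed.

(** Where the gauge is between [1] and [2], the values of [h] are controlled
    only by the Lipschitz condition, used here between [0] and [x]. *)
Lemma cutoff_bounded x : `|h x| <= 1 + 2 * n%:R.
Proof.
have nR : 0 <= n%:R :> R by [].
have [x2|x2] := leP 2 (gauge sh x).
  by case: ch => _ -> // _; rewrite normr0; lra.
have h01 : h 0 = 1.
  by case: ch => h1 _ _; apply: h1; rewrite gauge0.
have := cutoff_lipschitz x 0; rewrite h01 subr0 => hx.
have xn := enorm_le_gauge sh x.
have : n%:R * gauge sh x <= n%:R * 2 by rewrite ler_wpM2l// ltW.
have := ler_normD (h x - 1) 1; rewrite subrK normr1; lra.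
Qed.

(** Multiplying by [r] makes the Lipschitz constant equal to [1]. *)
Lemma measurable_dilated_cutoff :
  measurable_fun [set: lebesgue_space R n] (fun x : 'rV[R]_n => h (r^-1 *: x)).
Proof.
apply: measurable_fun_borel.
apply: (eq_measurable_fun (fun x : 'rV[R]_n => r^-1 * (r * h (r^-1 *: x)))).
  by move=> x _; rewrite mulKf// gt_eqF.
apply: measurable_funM => //; apply: measurable_lipschitz => x y.
rewrite -mulrBr normrM gtr0_norm// mulrC -ler_pdivlMr//.
apply: le_trans (cutoff_lipschitz _ _) _.
rewrite -scalerBr -[X in X <= _]/(gauge Ball _).
by rewrite gaugeZ gtr0_norm ?invr_gt0// mulrC.
Qed.

End dilated_cutoff.
End cutoff.

(** * Truncation by a cutoff *)

Section decomposition.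
Context (R : realType) (n : nat) (sh : cell_shape) (p lam : R).
Hypotheses (n_gt0 : (0 < n)%N) (p1 : 1 <= p).
Hypothesis lam_bounds : - (n%:R / p) <= lam <= 1.
Variable h : 'rV[R]_n -> R.
Hypothesis ch : cutoff sh h.
Implicit Types (x y : 'rV[R]_n) (r s t rho N : R).
Implicit Types (f g : lebesgue_space R n -> R).

Let mu := lebesgue_rV R n.
Let lam1 : lam <= 1. Proof. by case/andP: lam_bounds. Qed.
Let mQ x s : measurable (Qat sh x s : set (lebesgue_space R n)).
Proof. exact: measurable_Qat. Qed.

Definition truncation f r : lebesgue_space R n -> R :=
  fun x : 'rV[R]_n => (f x - average f (Q sh (2 * r))) * h (r^-1 *: x).

Definition cutoff_bound : R := 1 + 2 * n%:R.

Definition far_const : R :=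
  n%:R `^ (n%:R / p) * 4 `^ (n%:R / p + lam) * cutoff_bound.

Definition near_const : R :=
  4 * (cutoff_bound + 48 * doubling_const n p * n%:R).

Lemma cutoff_bound_ge0 : 0 <= cutoff_bound.
Proof. by rewrite addr_ge0// mulr_ge0. Qed.

Lemma near_const_ge0 : 0 <= near_const.
Proof.
by rewrite mulr_ge0// addr_ge0 ?cutoff_bound_ge0// !mulr_ge0// powR_ge0.
Qed.

Lemma far_const_ge0 : 0 <= far_const.
Proof. by rewrite !mulr_ge0 ?powR_ge0 ?cutoff_bound_ge0. Qed.

Lemma measurable_truncation f r : 0 < r ->
  measurable_fun [set: lebesgue_space R n] f ->
  measurable_fun [set: lebesgue_space R n] (truncation f r).
Proof.
move=> r0 mf; apply: measurable_funM.
  exact: measurable_funB.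
exact: (measurable_dilated_cutoff ch r0).
Qed.

(** The power of [2 r / s], at most [4], has exponent [n/p + lam >= 0]. *)
Lemma truncation_far f r N x s : measurable_fun [set: lebesgue_space R n] f ->
  0 < r -> 0 <= N -> r / 2 <= s ->
  (campanato_norm sh p lam (Q sh (3 * r)) f <= N%:E)%E ->
  Lp_close mu p (truncation f r) (Qat sh x s) 0 (far_const * N * s `^ lam).
Proof.
move=> mf r0 N0 rs fN; have hp := p1; have s0 : 0 < s by lra.
have r20 : 0 < 2 * r by lra.
have nR0 : 0 < n%:R :> R by rewrite ltr0n.
have sub : Qat sh (0 : 'rV[R]_n) (2 * r) `<=` Q sh (3 * r).
  by rewrite -Qat0; apply: subset_Qat; rewrite subrr gauge0; lra.
have fQ := Lp_close_cell n_gt0 p1 r20 N0 sub fN.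
have B0 : 0 <= N * (2 * r) `^ lam by rewrite mulr_ge0 ?powR_ge0.
have K0 : 0 <= (n%:R * (2 * r) / s) `^ (n%:R / p) by exact: powR_ge0.
have close : Lp_close mu p (truncation f r) (Qat sh x s) 0
    ((n%:R * (2 * r) / s) `^ (n%:R / p) *
     (cutoff_bound * (N * (2 * r) `^ lam))).
  apply: (Lp_close_restrict p1 (mQ x s) (mQ 0 (2 * r)) _ _ K0
    cutoff_bound_ge0 B0 (lebesgue_rV_Qat_ratio sh x 0 n_gt0 p1 s0 r20) _ _ fQ).
  - by apply: measurable_funTS; exact: measurable_truncation.
  - exact: measurable_funTS.
  - move=> y _ _; rewrite subr0 normrM mulrC Qat0.
    by rewrite ler_wpM2r// (cutoff_bounded ch).
  - move=> y _; rewrite Qat0 /Q/= => /negP; rewrite -leNgt => ry.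
    by rewrite /truncation (dilated_cutoff_eq0 ch r0 ry) mulr0.
apply: (Lp_close_mono p1 _ _ close).
  by rewrite !mulr_ge0 ?powR_ge0 ?cutoff_bound_ge0.
have e0 : 0 <= n%:R / p + lam by case/andP: lam_bounds => ? _; lra.
set q := n%:R / p in e0 *.
have ratio : (2 * r / s) `^ q * (2 * r) `^ lam <= 4 `^ (q + lam) * s `^ lam.
  have -> : (2 * r) `^ lam = (2 * r / s) `^ lam * s `^ lam.
    by rewrite -powRM ?divfK// ?gt_eqF// ?divr_ge0//; lra.
  rewrite mulrA ler_wpM2r ?powR_ge0// -powRD; last first.
    by apply/implyP => _; rewrite gt_eqF// divr_gt0.
  apply: ge0_ler_powR; rewrite ?nnegrE//; first by rewrite divr_ge0; lra.
  by rewrite ler_pdivrMr//; lra.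
rewrite -mulrA powRM ?divr_ge0//; try lra.
rewrite /far_const -/q; set b := cutoff_bound; set m := n%:R `^ q.
have mbN : 0 <= m * b * N by rewrite !mulr_ge0 ?powR_ge0 ?cutoff_bound_ge0.
have := ler_wpM2l mbN ratio; rewrite -mulrA; lra.
Qed.

(** The constant is the value at the centre [x] of the product of
    [f_Q - f_{Q_2r}] and the cutoff. *)
Lemma truncation_near f r N x s : measurable_fun [set: lebesgue_space R n] f ->
  0 < r -> 0 <= N -> 0 < s -> s < r / 2 ->
  (campanato_norm sh p lam (Q sh (3 * r)) f <= N%:E)%E ->
  exists c, Lp_close mu p (truncation f r) (Qat sh x s) c
    (near_const * N * s `^ lam).
Proof.
move=> mf r0 N0 s0 sr fN; have hp := p1.
have Ns0 : 0 <= N * s `^ lam by rewrite mulr_ge0 ?powR_ge0.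
(* [y] is a point of the cell where the truncation may be nonzero *)
have [[y /= [yx yr]]|outside] :=
  pselect (exists y, Qat sh x s y /\ gauge sh y < 2 * r); last first.
  exists 0; apply: Lp_close_eq => //.
    by rewrite -mulrA mulr_ge0 ?near_const_ge0.
  move=> y yx; rewrite /truncation (dilated_cutoff_eq0 ch r0) ?mulr0//.
  by rewrite leNgt; apply/negP => yr; apply: outside; exists y.
have x3r : gauge sh x + s <= 3 * r.
  have := gaugeD sh (x - y) y; rewrite subrK gauge_distC.
  by move: yx; rewrite Qat_E/=; lra.
have sub : Qat sh x s `<=` Q sh (3 * r).
  by rewrite -Qat0; apply: subset_Qat; rewrite subr0.
have fQ := Lp_close_cell n_gt0 p1 s0 N0 sub fN.
pose a := average f (Q sh (2 * r)); pose b := average f (Qat sh x s).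
have sl0 : 0 < s `^ (lam - 1) by rewrite powR_gt0.
have D0 : 0 <= doubling_const n p by exact: powR_ge0.
pose E := 4 * doubling_const n p * N * s `^ (lam - 1).
have E0 : 0 <= E by rewrite !mulr_ge0 ?powR_ge0.
(* the two averages are compared through that on [Q_{3r}] *)
have ba : `|b - a| <= 12 * r * E.
  have c1 : `|b - average f (Q sh (3 * r))| <= 6 * r * E.
    apply: le_trans (average_chain n_gt0 p1 lam1 mf s0 x3r N0 fN) _.
    rewrite (_ : _ * N = (2 * (3 * r) - s) * E); last by rewrite /E; ring.
    by rewrite ler_wpM2r//; lra.
  have r20 : 0 < 2 * r by lra.
  have o3r : gauge sh (0 : 'rV[R]_n) + 2 * r <= 3 * r by rewrite gauge0; lra.
  have c2 : `|a - average f (Q sh (3 * r))| <= 6 * r * E.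
    have := average_chain n_gt0 p1 lam1 mf r20 o3r N0 fN.
    rewrite Qat0 -/a => /le_trans; apply.
    have lr : (2 * r) `^ (lam - 1) <= s `^ (lam - 1).
      by apply: powR_antimono; have := lam1; lra.
    have DN : 0 <= 16 * doubling_const n p * r * N by rewrite !mulr_ge0// ltW.
    have := ler_wpM2l DN lr; have : 0 <= r * E by rewrite mulr_ge0// ltW.
    rewrite /E; lra.
  rewrite (_ : b - a = (b - average f (Q sh (3 * r))) -
    (a - average f (Q sh (3 * r)))); last by ring.
  by apply: le_trans (ler_normB _ _) _; lra.
exists ((b - a) * h (r^-1 *: x)).
pose D := 48 * doubling_const n p * n%:R * (N * s `^ lam).
have D'0 : 0 <= D by rewrite !mulr_ge0 ?powR_ge0.
have Qoo : (mu (Qat sh x s) < +oo)%E.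
  by case/andP: (lebesgue_rV_Qat_gt0 sh x n_gt0 s0).
have mfQ : measurable_fun (Qat sh x s : set (lebesgue_space R n)) f.
  exact: measurable_funTS.
have m0 := cutoff_bound_ge0.
have scaled : Lp_close mu p (fun y => cutoff_bound * f y) (Qat sh x s)
    (cutoff_bound * b) (cutoff_bound * (N * s `^ lam)).
  apply: (Lp_close_le p1 (mQ x s) mfQ _ m0 Ns0 _ fQ).
    exact: measurable_funM.
  by move=> z _; rewrite -mulrBr normrM ger0_norm.
rewrite (_ : near_const * N * s `^ lam =
  4 * (cutoff_bound * (N * s `^ lam) + D)); last first.
  by rewrite /near_const /D; ring.
apply: (Lp_close_leD p1 (mQ x s) _ _ _ _ D'0 _ scaled
  (Lp_close_cst p (mQ x s) Qoo D'0)).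
- exact: measurable_funM.
- exact: measurable_cst.
- by apply: measurable_funTS; exact: measurable_truncation.
- by rewrite mulr_ge0.
move=> z; rewrite Qat_E/= => zx; rewrite /truncation -/a subr0 (ger0_norm D'0).
rewrite (_ : _ - _ = (f z - b) * h (r^-1 *: z) +
  (b - a) * (h (r^-1 *: z) - h (r^-1 *: x))); last by ring.
apply: le_trans (ler_normD _ _) _; rewrite !normrM; apply: lerD.
  rewrite -mulrBr normrM (ger0_norm m0) mulrC.
  by rewrite ler_wpM2r// (cutoff_bounded ch).
apply: le_trans (ler_pM _ _ ba (dilated_cutoff_lipschitz ch r0 _ _)) _ => //.
have nR0 : 0 <= n%:R :> R by [].
have zxn : n%:R * gauge sh (z - x) / r <= n%:R * s / r.
  by rewrite ler_pM2r ?invr_gt0// ler_wpM2l// ltW.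
have rE0 : 0 <= 12 * r * E by rewrite !mulr_ge0// ltW.
apply: le_trans (ler_wpM2l rE0 zxn) _.
rewrite /E /D [in leRHS](powR_pred _ s0) le_eqVlt; apply/orP; left; apply/eqP.
by field; rewrite gt_eqF.
Qed.

Lemma truncation_close f r N x s : measurable_fun [set: lebesgue_space R n] f ->
  0 < r -> 0 <= N -> 0 < s ->
  (campanato_norm sh p lam (Q sh (3 * r)) f <= N%:E)%E ->
  exists c, Lp_close mu p (truncation f r) (Qat sh x s) c
    ((far_const + near_const) * N * s `^ lam).
Proof.
move=> mf r0 N0 s0 fN.
have [F0 G0] := (far_const_ge0, near_const_ge0).
have Ns0 : 0 <= N * s `^ lam by rewrite mulr_ge0 ?powR_ge0.
have [rs|sr] := leP (r / 2) s.
  exists 0; apply: (Lp_close_mono p1 _ _ (truncation_far x mf r0 N0 rs fN)).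
    by rewrite -mulrA mulr_ge0.
  by rewrite -[leLHS]mulrA -[leRHS]mulrA ler_wpM2r// lerDl.
have [c close] := truncation_near x mf r0 N0 s0 sr fN.
exists c; apply: (Lp_close_mono p1 _ _ close); first by rewrite -mulrA mulr_ge0.
by rewrite -[leLHS]mulrA -[leRHS]mulrA ler_wpM2r// lerDr.
Qed.

Lemma campanato_norm_truncation_inner f r t N :
  measurable_fun [set: lebesgue_space R n] f -> 0 < t -> t < r -> 0 <= N ->
  (campanato_norm sh p lam (Q sh t) f <= N%:E)%E ->
  (campanato_norm sh p lam (Q sh t) (truncation f r) <= (12 * N)%:E)%E.
Proof.
move=> mf t0 tr N0 fN; have r0 : 0 < r by lra.
have mT := measurable_truncation r0 mf.
apply: (campanato_norm_le n_gt0 p1 mT N0) => x s s0 sub.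
exists (average f (Qat sh x s) - average f (Q sh (2 * r))).
rewrite -[N * _]mul1r.
apply: (Lp_close_le p1 (mQ x s) (measurable_funTS mf) (measurable_funTS mT)
  ler01 _ _
  (Lp_close_cell n_gt0 p1 s0 N0 sub fN)).
  by rewrite mulr_ge0 ?powR_ge0.
move=> y /sub yt; rewrite /truncation (dilated_cutoff_eq1 ch r0); last first.
  by move: yt; rewrite /Q/=; lra.
by rewrite mulr1 mul1r opprB addrA subrK.
Qed.

Lemma campanato_norm_truncation_outer f r t N :
  measurable_fun [set: lebesgue_space R n] f -> 0 < r -> 0 <= N ->
  (campanato_norm sh p lam (Q sh (3 * r)) f <= N%:E)%E ->
  (campanato_norm sh p lam (Q sh t) (truncation f r) <=
    (12 * ((far_const + near_const) * N))%:E)%E.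
Proof.
move=> mf r0 N0 fN; have mT := measurable_truncation r0 mf.
have B0 : 0 <= (far_const + near_const) * N.
  by rewrite mulr_ge0// addr_ge0 ?far_const_ge0 ?near_const_ge0.
apply: (campanato_norm_le n_gt0 p1 mT B0) => x s s0 _.
exact: truncation_close.
Qed.

Lemma campanato_norm_remainder_inner f r t :
  measurable_fun [set: lebesgue_space R n] f -> 0 < t -> t < r ->
  (campanato_norm sh p lam (Q sh t)
    (fun x => (f x - truncation f r x)%R) <= 0)%E.
Proof.
move=> mf t0 tr; have r0 : 0 < r by lra.
have mT := measurable_truncation r0 mf.
rewrite (_ : 0%E = (12 * 0)%:E); last by rewrite mulr0.
have mfT : measurable_fun [set: lebesgue_space R n]
  (fun x => f x - truncation f r x) by exact: measurable_funB mf mT.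
apply: (campanato_norm_le n_gt0 p1 mfT (lexx 0)) => x s s0 sub.
exists (average f (Q sh (2 * r))).
rewrite mul0r; apply: Lp_close_eq => // y /sub yt.
rewrite /truncation (dilated_cutoff_eq1 ch r0).
  by rewrite mulr1 opprB addrC subrK.
by move: yt; rewrite /Q/=; lra.
Qed.

Lemma campanato_norm_remainder_outer f r t N :
  measurable_fun [set: lebesgue_space R n] f -> 0 < r -> r <= t -> 0 <= N ->
  (campanato_norm sh p lam (Q sh (3 * t)) f <= N%:E)%E ->
  (campanato_norm sh p lam (Q sh t) (fun x => (f x - truncation f r x)%R) <=
    (12 * (4 * (1 + (far_const + near_const)) * N))%:E)%E.
Proof.
move=> mf r0 rt N0 fN; have mT := measurable_truncation r0 mf.
have [F0 G0] := (far_const_ge0, near_const_ge0).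
have f3r : (campanato_norm sh p lam (Q sh (3 * r)) f <= N%:E)%E.
  by apply: le_trans fN; apply: campanato_norm_subset; apply: subset_Q; lra.
have ft : (campanato_norm sh p lam (Q sh t) f <= N%:E)%E.
  by apply: le_trans fN; apply: campanato_norm_subset; apply: subset_Q; lra.
have B0 : 0 <= 4 * (1 + (far_const + near_const)) * N.
  by rewrite !mulr_ge0// !addr_ge0.
have mfT : measurable_fun [set: lebesgue_space R n]
  (fun x => f x - truncation f r x) by exact: measurable_funB mf mT.
apply: (campanato_norm_le n_gt0 p1 mfT B0) => x s s0 sub.
have [c Tc] := truncation_close x mf r0 N0 s0 f3r.
have fQ := Lp_close_cell n_gt0 p1 s0 N0 sub ft.
exists (average f (Qat sh x s) - c).
have Ns0 : 0 <= N * s `^ lam by rewrite mulr_ge0 ?powR_ge0.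
rewrite (_ : _ * s `^ lam = 4 * (N * s `^ lam +
  (far_const + near_const) * N * s `^ lam)); last by ring.
apply: (Lp_close_leD p1 (mQ x s) _ _ _ Ns0 _ _ fQ Tc).
- exact: measurable_funTS.
- exact: measurable_funTS.
- by apply: measurable_funTS; exact: measurable_funB.
- by rewrite -mulrA mulr_ge0// addr_ge0.
move=> y _.
rewrite (_ : _ - _ = (f y - average f (Qat sh x s)) - (truncation f r y - c)).
  exact: ler_normB.
by ring.
Qed.

End decomposition.

(** * The decomposition *)

Section campanato_decomposition.
Context (R : realType) (n : nat) (sh : cell_shape) (p lam : R).
Hypotheses (n_gt0 : (0 < n)%N) (p1 : 1 <= p).
Hypothesis lam_bounds : - (n%:R / p) <= lam <= 1.

Local Notation norm t g := (campanato_norm sh p lam (Q sh t) g).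

Lemma campanato_norm_fin f t : global_space (campanato_spaces n sh p lam) f ->
  0 < t -> exists2 N : R, 0 <= N & norm t f = N%:E.
Proof.
move=> [_ ft] t0; have [_ foo] := ft _ t0.
have n0 := campanato_norm_ge0 sh p lam f t0.
exists (fine (norm t f)); first exact: fine_ge0.
by rewrite fineK// ge0_fin_numE.
Qed.

Let eq_lee (x y : \bar R) : x = y -> (x <= y)%E. Proof. by move=> ->. Qed.

Definition decomposition_const : R :=
  48 * (1 + (far_const n p lam + near_const n p)).

Lemma decomposition_const_ge : 48 <= decomposition_const.
Proof.
have := far_const_ge0 n p lam; have := near_const_ge0 n p.
by rewrite /decomposition_const; lra.
Qed.

Lemma truncation_decomposition h f r : cutoff sh h ->
  global_space (campanato_spaces n sh p lam) f -> 0 < r ->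
  let f0 := truncation sh h f r in
  let f1 := (fun x => f x - truncation sh h f r x)%R in
  [/\ (forall t, 0 < t < r -> (norm t f0 <=
         decomposition_const%:E * norm t f)%E),
      (forall t, r <= t -> (norm t f0 <=
         decomposition_const%:E * norm (3 * r)%R f)%E),
      (forall t, 0 < t < r -> (norm t f1 <= 0)%E) &
      (forall t, r <= t -> (norm t f1 <=
         decomposition_const%:E * norm (3 * t)%R f)%E)].
Proof.
move=> ch Ef r0.
have mf : measurable_fun [set: lebesgue_space R n] f by case: Ef.
have C48 := decomposition_const_ge.
have [F0 G0] := (far_const_ge0 n p lam, near_const_ge0 n p).
split=> t.
- move=> /andP[t0 tr]; have [N N0 fN] := campanato_norm_fin Ef t0.
  have := campanato_norm_truncation_inner n_gt0 p1 ch mf t0 tr N0 (eq_lee fN).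
  move=> /le_trans; apply; rewrite fN lee_fin; nra.
- move=> rt; have r30 : 0 < 3 * r by lra.
  have [N N0 fN] := campanato_norm_fin Ef r30.
  have := campanato_norm_truncation_outer n_gt0 p1 lam_bounds ch t mf r0 N0
    (eq_lee fN).
  move=> /le_trans; apply; rewrite fN lee_fin /decomposition_const; nra.
- by move=> /andP[t0 tr]; apply: campanato_norm_remainder_inner.
- move=> rt; have t30 : 0 < 3 * t by lra.
  have [N N0 fN] := campanato_norm_fin Ef t30.
  have := campanato_norm_remainder_outer n_gt0 p1 lam_bounds ch mf r0 rt N0
    (eq_lee fN).
  move=> /le_trans; apply; rewrite fN lee_fin /decomposition_const; nra.
Qed.

Lemma campanato_truncation h f r t : cutoff sh h ->
  global_space (campanato_spaces n sh p lam) f -> 0 < r -> 0 < t ->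
  campanato sh p lam (Q sh t) (truncation sh h f r) /\
  campanato sh p lam (Q sh t) (fun x => f x - truncation sh h f r x).
Proof.
move=> ch Ef r0 t0.
have mf : measurable_fun [set: lebesgue_space R n] f by case: Ef.
have mT := measurable_truncation ch r0 mf.
have lt u a b : 0 < u -> (a <= b%:E * norm u f)%E -> (a < +oo)%E.
  move=> u0 /le_lt_trans; apply; have [N _ ->] := campanato_norm_fin Ef u0.
  by rewrite -EFinM ltry.
have [i0 o0 i1 o1] := truncation_decomposition ch Ef r0.
split; split.
- exact: (measurable_funTS mT).
- have [rt|tr] := leP r t; first by apply: lt (o0 _ rt); lra.
  by apply: lt (i0 t _); rewrite ?t0.
- exact: (measurable_funTS (measurable_funB mf mT)).
have [rt|tr] := leP r t; first by apply: lt (o1 _ rt); lra.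
by apply: le_lt_trans (i1 t _) _; rewrite ?t0// ltry.
Qed.

End campanato_decomposition.


Unset Implicit Arguments.
Theorem proposition3p6 (R : realType) (n : nat) (n_gt0 : (0 < n)%N)
    (sh : cell_shape) (p lam : R) (p_ge1 : 1 <= p)
    (lam_bounds : - (n%:R / p) <= lam <= 1) :
  decomposition_property (campanato_spaces n sh p lam) /\
  forall h : 'rV[R]_n -> R, cutoff sh h ->
  exists C : R, 0 < C /\
  forall f : 'rV[R]_n -> R, global_space (campanato_spaces n sh p lam) f ->
  forall r : R, 0 < r ->
  let norm (t : R) (g : 'rV[R]_n -> R) := campanato_norm sh p lam (Q sh t) g in
  let hr (x : 'rV[R]_n) := h (r^-1 *: x) in
  let f0 (x : 'rV[R]_n) := (f x - average f (Q sh (2 * r))) * hr x in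
  let f1 (x : 'rV[R]_n) := f x - (f x - average f (Q sh (2 * r))) * hr x in
  [/\ (forall x, f x = f0 x + f1 x),
      (forall t : R, 0 < t < r -> (norm t f0 <= C%:E * norm t f)%E),
      (forall t : R, r <= t -> (norm t f0 <= C%:E * norm (3 * r)%R f)%E),
      (forall t : R, 0 < t < r -> (norm t f1 <= 0)%E) &
      (forall t : R, r <= t -> (norm t f1 <= C%:E * norm (3 * t)%R f)%E)].
Proof.
have C0 : 0 < decomposition_const n p lam.
  by apply: lt_le_trans (decomposition_const_ge n p lam).
split; last first.
  move=> h ch; exists (decomposition_const n p lam); split => //.
  move=> f Ef r r0 norm hr f0 f1; have [i0 o0 i1 o1] :=
    truncation_decomposition n_gt0 p_ge1 lam_bounds ch Ef r0.
  by split => // x; rewrite /f1 /f0 addrC subrK.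
have [h ch] := cutoff_exists R n sh.
exists (decomposition_const n p lam), 3, 3, 1; split=> // f Ef r r0.
exists (truncation sh h f r), (fun x => f x - truncation sh h f r x).
have [i0 o0 i1 o1] := truncation_decomposition n_gt0 p_ge1 lam_bounds ch Ef r0.
split.
- by move=> x; rewrite addrC subrK.
- by move=> t t0; exact: campanato_truncation.
- by split; [exact: i0|exact: o0].
- move=> t; rewrite mul1r => tr; apply/eqP; rewrite eq_le i1//.
  by apply: campanato_norm_ge0; case/andP: tr.
- by move=> t; rewrite mul1r; exact: o1.
Qed.
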